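(* Problem $(P^{M}_{\le k})$ can be (polynomially) reduced to the weighted matroid intersection problem (for two matroids).
   Context: An instance of $(P^M_{\le k})$ consists of matroids $\mathcal{M}_1=(E,\mathcal{B}_1),\dots,\mathcal{M}_M=(E,\mathcal{B}_M)$ on a common finite ground set $E$ with base sets $\mathcal{B}_1,\dots,\mathcal{B}_M$ (given by independence oracles), an integer $k\in\mathbb{N}$, and cost functions $c_1,\dots,c_M\colon E\to\mathbb{R}$. The problem is to minimize $\sum_{i=1}^M c_i(X_i)$ subject to $X_i\in\mathcal{B}_i$ for all $i=1,\dots,M$ and $\bigl|\bigcap_{i=1}^M X_i\bigr|\le k$, where $c_i(S)=\sum_{e\in S}c_i(e)$. Weighted matroid intersection problem: given two matroids $\mathcal{N}_1=(\tilde E,\tilde{\mathcal{F}}_1)$, $\mathcal{N}_2=(\tilde E,\tilde{\mathcal{F}}_2)$ on a common ground set (with families of independent sets $\tilde{\mathcal{F}}_1,\tilde{\mathcal{F}}_2$, given by independence oracles) and weights $w\colon\tilde E\to\mathbb{R}$, maximize $\sum_{e\in A}w(e)$ over $A\in\tilde{\mathcal{F}}_1\cap\tilde{\mathcal{F}}_2$. ''Reduced'' means: from any instance of $(P^M_{\le k})$ one can construct in polynomial time an instance of weighted matroid intersection (whose independence oracles are simulated in polynomial time using the oracles of the $\mathcal{M}_i$) such that from any optimal solution of the latter one obtains in polynomial time an optimal solution of the former, or the conclusion that the former is infeasible. *)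

(* Defs.v *)
From HB Require Import structures.
From mathcomp Require Import all_boot all_order all_algebra.
From mathcomp Require Import reals.

Set Implicit Arguments.
Unset Strict Implicit.
Unset Printing Implicit Defensive.

Import Order.TTheory GRing.Theory Num.Theory.

Record matroid (E : finType) := Matroid {
  indep : {set {set E}};
  indep0 : set0 \in indep;
  indep_hereditary : forall A B : {set E},
    A \subset B -> B \in indep -> A \in indep;
  indep_exchange : forall A B : {set E},
    A \in indep -> B \in indep -> #|A| < #|B| ->
    exists2 x, x \in B :\: A & x |: A \in indep
}.

Definition bases (E : finType) (N : matroid E) : {set {set E}} :=
  [set B | maxset (mem (indep N)) B].

(* The ground set is listed as {0, ..., n-1} and the matroids as
   0, ..., M-1, so that a program can name them. *)
Record pk_instance (R : realType) := PkInstance {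
  pk_n : nat;
  pk_M : nat;
  pk_M_gt0 : 0 < pk_M;
  pk_matroid : 'I_pk_M -> matroid 'I_pk_n;
  pk_k : nat;
  pk_cost : 'I_pk_M -> 'I_pk_n -> R
}.

Definition pk_feasible (R : realType) (I : pk_instance R)
    (X : 'I_(pk_M I) -> {set 'I_(pk_n I)}) : Prop :=
  (forall i, X i \in bases (pk_matroid i)) /\
  #|\bigcap_(i < pk_M I) X i| <= pk_k I.

Definition pk_value (R : realType) (I : pk_instance R)
    (X : 'I_(pk_M I) -> {set 'I_(pk_n I)}) : R :=
  (\sum_(i < pk_M I) \sum_(e in X i) pk_cost i e)%R.

Definition pk_optimal (R : realType) (I : pk_instance R)
    (X : 'I_(pk_M I) -> {set 'I_(pk_n I)}) : Prop :=
  pk_feasible X /\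
  forall Y : 'I_(pk_M I) -> {set 'I_(pk_n I)},
    pk_feasible Y -> (pk_value X <= pk_value Y)%R.

Record wmi_instance (R : realType) := WmiInstance {
  wmi_m : nat;
  wmi_N1 : matroid 'I_wmi_m;
  wmi_N2 : matroid 'I_wmi_m;
  wmi_weight : 'I_wmi_m -> R
}.

Definition wmi_feasible (R : realType) (J : wmi_instance R)
    (A : {set 'I_(wmi_m J)}) : Prop :=
  A \in indep (wmi_N1 J) :&: indep (wmi_N2 J).

Definition wmi_value (R : realType) (J : wmi_instance R)
    (A : {set 'I_(wmi_m J)}) : R :=
  (\sum_(e in A) wmi_weight e)%R.

Definition wmi_optimal (R : realType) (J : wmi_instance R)
    (A : {set 'I_(wmi_m J)}) : Prop :=
  wmi_feasible A /\
  forall B : {set 'I_(wmi_m J)}, wmi_feasible B ->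
    (wmi_value B <= wmi_value A)%R.

(* Model of computation: an oracle random access machine with one memory of
   natural numbers and one memory of real numbers, programmed by while
   programs.  Arithmetic is additive only (no multiplication) and the only
   real constants are natural numbers: t steps then lengthen the numbers by
   O(t) bits, so that counting every command as one step is, on rational data,
   polynomially equivalent to counting bit operations, while still making
   sense for real costs.  Expressions are part of the program text, hence of
   constant size, and are not charged separately. *)
Inductive nexp :=
  | NConst of nat
  | NGet of nexp                 (* content of the cell with this address *)
  | NAdd of nexp & nexp
  | NSub of nexp & nexp.         (* truncated *)

Inductive rexp :=
  | RConst of nat
  | RGet of nexp
  | RAdd of rexp & rexp
  | RSub of rexp & rexp.

Inductive bexp :=
  | NLe of nexp & nexp
  | RLe of rexp & rexp
  | BNot of bexp
  | BAnd of bexp & bexp.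

(* NSet a v and RSet a v store v at address a.  Query a i b stores at address
   a the answer of the independence oracle of matroid i on the set whose
   indicator vector starts at address b. *)
Inductive cmd :=
  | Skip
  | NSet of nexp & nexp
  | RSet of nexp & rexp
  | Query of nexp & nexp & nexp
  | Seq of cmd & cmd
  | If of bexp & cmd & cmd
  | While of bexp & cmd.

Record store (R : realType) := Store {
  nmem : nat -> nat;
  rmem : nat -> R
}.

Fixpoint neval (R : realType) (s : store R) (e : nexp) : nat :=
  match e with
  | NConst c => c
  | NGet a => nmem s (neval s a)
  | NAdd e1 e2 => neval s e1 + neval s e2
  | NSub e1 e2 => neval s e1 - neval s e2
  end.

Fixpoint reval (R : realType) (s : store R) (e : rexp) : R :=
  match e with
  | RConst c => (c%:R)%R
  | RGet a => rmem s (neval s a)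
  | RAdd e1 e2 => (reval s e1 + reval s e2)%R
  | RSub e1 e2 => (reval s e1 - reval s e2)%R
  end.

Fixpoint beval (R : realType) (s : store R) (b : bexp) : bool :=
  match b with
  | NLe e1 e2 => neval s e1 <= neval s e2
  | RLe e1 e2 => (reval s e1 <= reval s e2)%R
  | BNot b1 => ~~ beval s b1
  | BAnd b1 b2 => beval s b1 && beval s b2
  end.

Definition nwrite (R : realType) (s : store R) (a v : nat) : store R :=
  Store (fun x => if x == a then v else nmem s x) (rmem s).

Definition rwrite (R : realType) (s : store R) (a : nat) (v : R) : store R :=
  Store (nmem s) (fun x => if x == a then v else rmem s x).

(* An oracle receives the index of a matroid and an indicator function. *)
Definition oracle := nat -> (nat -> bool) -> bool.

(* exec orc c s t s': started in s, the program c halts in s' after t steps. *)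
Inductive exec (R : realType) (orc : oracle) :
    cmd -> store R -> nat -> store R -> Prop :=
  | ExecSkip s : exec orc Skip s 1 s
  | ExecNSet s a e : exec orc (NSet a e) s 1 (nwrite s (neval s a) (neval s e))
  | ExecRSet s a e : exec orc (RSet a e) s 1 (rwrite s (neval s a) (reval s e))
  | ExecQuery s a i b :
      exec orc (Query a i b) s 1
        (nwrite s (neval s a)
           (nat_of_bool
              (orc (neval s i) (fun j => nmem s (neval s b + j) != 0))))
  | ExecSeq s s' s'' c1 c2 t1 t2 :
      exec orc c1 s t1 s' -> exec orc c2 s' t2 s'' ->
      exec orc (Seq c1 c2) s (t1 + t2) s''
  | ExecIfTrue s s' b c1 c2 t :
      beval s b -> exec orc c1 s t s' -> exec orc (If b c1 c2) s t.+1 s'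
  | ExecIfFalse s s' b c1 c2 t :
      ~~ beval s b -> exec orc c2 s t s' -> exec orc (If b c1 c2) s t.+1 s'
  | ExecWhileFalse s b c :
      ~~ beval s b -> exec orc (While b c) s 1 s
  | ExecWhileTrue s s' s'' b c t1 t2 :
      beval s b -> exec orc c s t1 s' -> exec orc (While b c) s' t2 s'' ->
      exec orc (While b c) s (t1 + t2).+1 s''.

(* Execution is deterministic, so this is total correctness within T steps. *)
Definition runs_within (R : realType) (orc : oracle) (c : cmd) (s : store R)
    (T : nat) (post : store R -> Prop) : Prop :=
  exists (t : nat) (s' : store R), [/\ exec orc c s t s', t <= T & post s'].

Definition pk_oracle (R : realType) (I : pk_instance R) : oracle :=
  fun i f =>
    if insub i is Some i' then
      [set j : 'I_(pk_n I) | f j] \in indep (pk_matroid (i' : 'I_(pk_M I)))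
    else false.

Definition pk_size (R : realType) (I : pk_instance R) : nat := pk_n I + pk_M I.

(* Natural-number cells: n, M, k, the length of v, then the bits of v.
   Real cells: the costs, the cost of e for matroid i being at i * n + e.
   All further cells contain 0. *)
Definition pk_input (R : realType) (I : pk_instance R) (v : seq bool) :
    store R :=
  Store
    (nth 0 ([:: pk_n I; pk_M I; pk_k I; size v] ++ map nat_of_bool v))
    (nth 0%R [seq pk_cost i e | i <- enum 'I_(pk_M I), e <- enum 'I_(pk_n I)]).

Definition indicator (m : nat) (A : {set 'I_m}) : seq bool :=
  [seq i \in A | i <- enum 'I_m].

Definition writes_wmi (R : realType) (J : wmi_instance R) (s : store R) :
    Prop :=
  nmem s 0 = wmi_m J /\ forall j : 'I_(wmi_m J), rmem s j = wmi_weight j.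

Definition writes_bool (R : realType) (b : bool) (s : store R) : Prop :=
  nmem s 0 = nat_of_bool b.

Definition output_sets (R : realType) (I : pk_instance R) (s : store R)
    (i : 'I_(pk_M I)) : {set 'I_(pk_n I)} :=
  [set e : 'I_(pk_n I) | nmem s (1 + i * pk_n I + e) != 0].

(* Cell 0 tells whether a solution has been found. *)
Definition writes_answer (R : realType) (I : pk_instance R) (s : store R) :
    Prop :=
  (nmem s 0 = 0 /\ ~ exists X, @pk_feasible R I X) \/
  (nmem s 0 = 1 /\ pk_optimal (@output_sets R I s)).

(* The program build constructs the intersection instance J, orc1 and orc2
   simulate its two independence oracles, and recover translates an optimal
   solution of J back.  The bound on |J| has to be explicit: a number of
   exponential size can be computed by repeated doubling. *)
Definition reduces_instance (R : realType) (build orc1 orc2 recover : cmd)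
    (T : nat) (I : pk_instance R) (J : wmi_instance R) : Prop :=
  [/\ wmi_m J <= T,
      runs_within (pk_oracle I) build (pk_input I [::]) T (writes_wmi J),
      forall A : {set 'I_(wmi_m J)},
        runs_within (pk_oracle I) orc1 (pk_input I (indicator A)) T
          (writes_bool (A \in indep (wmi_N1 J))),
      forall A : {set 'I_(wmi_m J)},
        runs_within (pk_oracle I) orc2 (pk_input I (indicator A)) T
          (writes_bool (A \in indep (wmi_N2 J))) &
      forall A : {set 'I_(wmi_m J)}, wmi_optimal A ->
        runs_within (pk_oracle I) recover (pk_input I (indicator A)) T
          (@writes_answer R I)].

(* Main.v *)
Require Import Defs.
From mathcomp Require Import all_boot all_order all_algebra.
From mathcomp Require Import reals.
From mathcomp Require Import zify lra.

Set Implicit Arguments.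
Unset Strict Implicit.
Unset Printing Implicit Defensive.

Import Order.TTheory GRing.Theory Num.Theory.

(** The ground set of the intersection instance consists of M copies of E, one
    per matroid, so that a set A of copies is the same thing as a family of M
    subsets of E, its slices.  The first matroid is the direct sum of the given
    ones: its bases are the families of bases.  The second one is made of the
    sets with at most k full columns, the column of e being the set of its M
    copies; full columns are the elements of the intersection of the slices.
    This is a matroid because it is the union of a partition matroid (at most
    M - 1 copies of each e) and of the uniform matroid of rank k; the exchange
    property is proved by a direct count ([few_full_exchange]).  So the
    common independent sets that are bases of the direct sum are the feasible
    solutions.

    Maximizing a weight only yields a common independent set.  Giving a copy
    of cost c the weight C - c, with C larger than the sum of all absolute
    costs, makes cardinality the primary objective ([penalty_card]): if a
    feasible solution exists, then an optimal set is a basis of the direct sum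
    and has minimum cost among them; if an optimal set is not a basis, then
    there is no feasible solution ([wmi_optimal_slices]).

    The four programs are short because copy (i, e) is numbered i * n + e.
    The weights then occupy the cells of the costs, and the indicator vector of
    the i-th slice is a contiguous segment of that of A, to which the oracle
    can be applied in place.  Independence in the direct sum takes M queries,
    full columns are counted by strided scans, and being a basis is decided by
    asking, for each element outside A, whether it can be added to its slice.
    Each while loop is handled by an invariant indexed by a bound on the number
    of remaining iterations ([runs_within_while]); the loop-free pieces are
    evaluated by computation ([runs_within_loop_free]). *)

(** * Bases of a matroid *)

Lemma mem_basesP (E : finType) (N : matroid E) (X : {set E}) :
  reflect (X \in indep N /\ forall e, e \notin X -> e |: X \notin indep N)
          (X \in bases N).
Proof.
rewrite inE; apply: (iffP maxsetP) => [[iX maxX] | [iX maxX]]; split=> //.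
  move=> e eX; apply: contra eX => ieX.
  by rewrite -(maxX _ ieX (subsetUr _ _)) setU11.
move=> B iB sXB; apply/eqP; rewrite eqEsubset sXB andbT.
apply/subsetP=> e eB; apply/negPn/negP => /maxX /negP; apply.
by apply: indep_hereditary iB; rewrite subUset sub1set eB.
Qed.

(** Bases are equicardinal and independent sets extend to bases; the equality
    case is what turns a cardinality comparison into a test for bases. *)
Lemma indep_leqif_basis (E : finType) (N : matroid E) (A B : {set E}) :
  A \in indep N -> B \in bases N -> #|A| <= #|B| ?= iff (A \in bases N).
Proof.
have le_basis X Y : X \in indep N -> Y \in bases N -> #|X| <= #|Y|.
  move=> iX /mem_basesP[iY maxY]; rewrite leqNgt; apply/negP => ltYX.
  have [x /setDP[_ xY] ixY] := indep_exchange iY iX ltYX.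
  by have := maxY x xY; rewrite ixY.
move=> iA bB; split; first exact: le_basis.
apply/idP/idP => [/eqP eqAB | bA].
  apply/mem_basesP; split=> // e eA; apply/negP => ieA.
  by have := le_basis _ _ ieA bB; rewrite cardsU1 eA eqAB add1n ltnn.
have [iB _] := mem_basesP _ _ bB.
by rewrite eqn_leq !le_basis.
Qed.

(** * Two matroids on a disjoint union of copies of the ground set *)

Section Copies.

Variables (I E T : finType) (g : I * E -> T).
Hypothesis g_bij : bijective g.
Implicit Types (A B : {set T}).

Definition slice A (i : I) : {set E} := [set e | g (i, e) \in A].
Definition column A (e : E) : {set I} := [set i | g (i, e) \in A].
Definition full A : {set E} := [set e | column A e == setT].

Lemma glue_slices (X : I -> {set E}) : exists A, forall i, slice A i = X i.
Proof.
have [h hK _] := g_bij.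
exists [set t | (h t).2 \in X (h t).1] => i.
by apply/setP=> e; rewrite !inE hK.
Qed.

Lemma fullE A : full A = \bigcap_i slice A i.
Proof.
apply/setP=> e; rewrite inE; apply/eqP/bigcapP => [eqT i _ | inA].
  by rewrite inE; have := in_setT i; rewrite -eqT inE.
by apply/setP=> i; have := inA i isT; rewrite !inE => ->.
Qed.

Lemma slice0 i : slice set0 i = set0.
Proof. by apply/setP=> e; rewrite !inE. Qed.

Lemma sliceS A B i : A \subset B -> slice A i \subset slice B i.
Proof. by move/subsetP=> sAB; apply/subsetP=> e; rewrite !inE => /sAB. Qed.

Lemma slice_setU1 i e A j :
  slice (g (i, e) |: A) j = if j == i then e |: slice A j else slice A j.
Proof.
apply/setP=> e'; rewrite !inE (inj_eq (bij_inj g_bij)) xpair_eqE.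
by case: eqP => [->|_]; rewrite !inE.
Qed.

Lemma column_setU1 i e A e' :
  column (g (i, e) |: A) e' = if e' == e then i |: column A e' else column A e'.
Proof.
apply/setP=> j; rewrite !inE (inj_eq (bij_inj g_bij)) xpair_eqE andbC.
by case: eqP => [->|_]; rewrite !inE.
Qed.

Lemma big_slices (R : Type) (idx : R) (op : Monoid.com_law idx) A (F : T -> R) :
  \big[op/idx]_(t in A) F t =
  \big[op/idx]_i \big[op/idx]_(e in slice A i) F (g (i, e)).
Proof.
rewrite (reindex g) /=; last exact: onW_bij.
rewrite (eq_bigr (fun p => F (g (p.1, p.2)))); last by case.
rewrite pair_big_dep /=; apply: eq_bigl => -[i e] /=.
by rewrite inE.
Qed.

Lemma card_slices A : #|A| = \sum_i #|slice A i|.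
Proof.
by rewrite -sum1_card big_slices; apply: eq_bigr => i _; rewrite -sum1_card.
Qed.

Lemma card_columns A : #|A| = \sum_e #|column A e|.
Proof.
rewrite card_slices; under eq_bigr do rewrite -sum1_card big_mkcond.
rewrite exchange_big; apply: eq_bigr => e _.
by rewrite -sum1_card [RHS]big_mkcond; apply: eq_bigr => i _; rewrite !inE.
Qed.

Section DirectSum.

Variable N : I -> matroid E.

Definition sum_indep : {set {set T}} :=
  [set A | [forall i, slice A i \in indep (N i)]].

Lemma sum_indep0 : set0 \in sum_indep.
Proof. by rewrite inE; apply/forallP=> i; rewrite slice0 indep0. Qed.

Lemma sum_indep_hereditary A B :
  A \subset B -> B \in sum_indep -> A \in sum_indep.
Proof.
rewrite !inE => sAB /forallP iB; apply/forallP=> i.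
exact: indep_hereditary (sliceS i sAB) (iB i).
Qed.

(** Cardinality is additive over the slices, so some slice of [B] is larger
    than that of [A], and an exchange there leaves the other slices alone. *)
Lemma sum_indep_exchange A B : A \in sum_indep -> B \in sum_indep ->
  #|A| < #|B| -> exists2 x, x \in B :\: A & x |: A \in sum_indep.
Proof.
rewrite !inE => /forallP iA /forallP iB ltAB.
have [i lti] : exists i, #|slice A i| < #|slice B i|.
  apply/existsP; apply: contraTT ltAB => /existsPn leBA.
  rewrite -leqNgt !card_slices; apply: leq_sum => i _.
  by rewrite leqNgt leBA.
have [e eBA ieA] := indep_exchange (iA i) (iB i) lti.
exists (g (i, e)); first by move: eBA; rewrite !inE.
rewrite inE; apply/forallP=> j; rewrite slice_setU1.
by case: eqP => [->|_].
Qed.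

Definition direct_sum : matroid T :=
  Matroid sum_indep0 sum_indep_hereditary sum_indep_exchange.

Lemma direct_sum_setU1 i e A : A \in indep direct_sum ->
  (g (i, e) |: A \in indep direct_sum) = (e |: slice A i \in indep (N i)).
Proof.
rewrite !inE => /forallP iA; apply/forallP/idP => [/(_ i) | ieA j].
  by rewrite slice_setU1 eqxx.
by rewrite slice_setU1; case: eqP => [->|_].
Qed.

Lemma mem_bases_direct_sum A :
  (A \in bases direct_sum) = [forall i, slice A i \in bases (N i)].
Proof.
have [h _ hK] := g_bij.
apply/mem_basesP/forallP => [[iA maxA] i | bA].
  apply/mem_basesP; split; first by move: iA; rewrite inE => /forallP.
  by move=> e eA; rewrite -direct_sum_setU1 // maxA //; move: eA; rewrite inE.
have iA : A \in indep direct_sum.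
  by rewrite inE; apply/forallP=> i; have /mem_basesP[] := bA i.
split=> // t; rewrite -(hK t); case: (h t) => i e tA.
rewrite direct_sum_setU1 //; have /mem_basesP[_] := bA i; apply.
by rewrite inE.
Qed.

End DirectSum.

Section FewFullColumns.

Variable k : nat.
Hypothesis I_gt0 : 0 < #|I|.

Definition few_full : {set {set T}} := [set A | #|full A| <= k].

Lemma fullS A B : A \subset B -> full A \subset full B.
Proof.
move=> sAB; rewrite !fullE; apply/bigcapsP=> i _.
by apply: subset_trans (sliceS i sAB); apply: bigcap_inf.
Qed.

(** With an empty index set every column would be full, whence [I_gt0]. *)
Lemma few_full0 : set0 \in few_full.
Proof.
have /card_gt0P[i _] := I_gt0.
rewrite inE fullE (leq_trans (subset_leq_card (bigcap_inf i _))) //.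
by rewrite slice0 cards0.
Qed.

Lemma few_full_hereditary A B : A \subset B -> B \in few_full -> A \in few_full.
Proof. by move=> sAB; rewrite !inE; apply/leq_trans/subset_leq_card/fullS. Qed.

Lemma full_setU1 i e A : full (g (i, e) |: A) =
  if i |: column A e == setT then e |: full A else full A :\ e.
Proof.
apply/setP=> e'; rewrite inE column_setU1.
have [-> | ne] := eqVneq e' e.
  by case: ifP => eqT; rewrite !inE eqxx // eqT.
by case: ifP => _; rewrite !inE (negPf ne).
Qed.

(** Suppose that no element of [B] can be added to [A].  Then [A] already has
    [k] full columns, and each column of [A] that misses an element of [B]
    lacks only that element.  Hence in each column [B] exceeds [A] by at most
    the difference of their numbers of full columns there; as [B] has at most
    [k] full columns, summing over all columns shows that [B] is not larger
    than [A]. *)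
Lemma few_full_exchange A B : A \in few_full -> B \in few_full ->
  #|A| < #|B| -> exists2 x, x \in B :\: A & x |: A \in few_full.
Proof.
rewrite !inE => fA fB ltAB.
apply/exists_inP; apply: contraTT ltAB => /exists_inPn stuck; rewrite -leqNgt.
have overfull i e : i \in column B e -> i \notin column A e ->
    i |: column A e = setT /\ #|full A| = k.
  rewrite !inE => iB iA.
  have := stuck (g (i, e)); rewrite !inE iB iA => /(_ isT).
  rewrite full_setU1 -ltnNge; case: eqP => [-> | _] lt_k.
    split=> //; apply/eqP; rewrite eqn_leq fA -ltnS (leq_trans lt_k) //.
    by rewrite cardsU1; case: (e \notin _); rewrite /= ?add1n ?add0n.
  have := leq_trans lt_k (subset_leq_card (subsetDl (full A) [set e])).
  by rewrite ltnNge fA.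
have [sBA | nsBA] := boolP (B \subset A); first exact: subset_leq_card.
have fullA : #|full A| = k.
  have [h _ hK] := g_bij.
  have /subsetPn[x xB xA] := nsBA; move: xB xA.
  rewrite -(hK x); case: (h x) => i e iB iA.
  by apply: (proj2 (overfull i e _ _)); rewrite inE.
suff: #|B| + #|full A| <= #|A| + #|full B| by lia.
have card_full S : #|full S| = \sum_e (column S e == setT).
  by rewrite -sum1_card big_mkcond; apply: eq_bigr => e _; rewrite inE; case: eqP.
rewrite !card_columns !card_full -!big_split; apply: leq_sum => e _ /=.
have [[leA eqA] [leB eqB]] := (subset_leqif_cards (subsetT (column A e)),
  subset_leqif_cards (subsetT (column B e))).
have [sBAe | /subsetPn[i iB iA]] := boolP (column B e \subset column A e).
  by have := subset_leq_card sBAe; lia.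
have [/(congr1 (fun S : {set I} => #|S|))] := overfull i e iB iA.
by rewrite cardsU1 iA => /=; lia.
Qed.

Definition few_full_matroid : matroid T :=
  Matroid few_full0 few_full_hereditary few_full_exchange.

End FewFullColumns.

End Copies.

(** * Reduction of the optimization problem *)

Section Penalty.

Variables (R : realType) (T : finType) (c : T -> R).
Local Open Scope ring_scope.

Definition penalty : R := 1 + \sum_t `|c t|.

Lemma sum_penalty (A : {set T}) :
  \sum_(t in A) (penalty - c t) = penalty *+ #|A| - \sum_(t in A) c t.
Proof. by rewrite sumrB sumr_const. Qed.

(** One more element gains [penalty], whereas the cost terms of two sets
    differ by at most the sum of all absolute costs, which is smaller. *)
Lemma penalty_card (A B : {set T}) : (#|A| < #|B|)%N ->
  \sum_(t in A) (penalty - c t) < \sum_(t in B) (penalty - c t).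
Proof.
move=> ltAB; rewrite !sum_penalty.
have ltC : \sum_(t in B) c t - \sum_(t in A) c t < penalty.
  apply: (@le_lt_trans _ _ (\sum_t `|c t|)); last by rewrite ltrDr.
  rewrite [X in X - _]big_mkcond [X in _ - X]big_mkcond -sumrB /=.
  apply: ler_sum => t _; case: ifP; case: ifP => _ _.
  - by rewrite subrr.
  - by rewrite subr0 ler_norm.
  - by rewrite sub0r -normrN ler_norm.
  by rewrite subr0.
have C_ge0 : 0 <= penalty by rewrite addr_ge0 // sumr_ge0.
have : penalty *+ #|A|.+1 <= penalty *+ #|B| by rewrite ler_wpMn2l.
by rewrite mulrS; lra.
Qed.

End Penalty.

Lemma nth_allpairs (A B C : Type) (f : A -> B -> C) (z : C) (x : A) (y : B)
    (s : seq A) (t : seq B) (i j : nat) :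
  i < size s -> j < size t ->
  nth z [seq f a b | a <- s, b <- t] (i * size t + j) =
  f (nth x s i) (nth y t j).
Proof.
move=> lti ltj; elim: s i lti => [|a s IHs] [|i] //= lti; rewrite nth_cat size_map.
  by rewrite mul0n add0n ltj (nth_map y).
by rewrite mulSn -addnA ltnNge leq_addr addKn IHs.
Qed.

Section Instance.

Variables (R : realType) (I : pk_instance R).
Notation n := (pk_n I).
Notation M := (pk_M I).
Notation N := (M * n).

Lemma copy_subproof (p : 'I_M * 'I_n) : p.1 * n + p.2 < N.
Proof. by have := ltn_ord p.1; have := ltn_ord p.2; nia. Qed.

Definition copy p : 'I_N := Ordinal (copy_subproof p).

Lemma copy_inj : injective copy.
Proof.
move=> [i e] [i' e'] /(congr1 val) /= eq_ie.
have n_gt0 : 0 < n := leq_ltn_trans (leq0n e) (ltn_ord e).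
congr (_, _); apply: val_inj => /=.
  by move/(congr1 (divn^~ n)): eq_ie; rewrite !divnMDl // !divn_small // !addn0.
by move/(congr1 (modn^~ n)): eq_ie; rewrite !modnMDl !modn_small.
Qed.

Lemma copy_bij : bijective copy.
Proof.
by apply: (inj_card_bij copy_inj); rewrite card_prod !card_ord.
Qed.

(** The input lists the costs in the order in which [copy] numbers the
    copies, so the cost of a copy is the content of the cell of that number. *)
Definition copy_cost (x : nat) : R := rmem (pk_input I [::]) x.

Lemma copy_costE i e : copy_cost (copy (i, e)) = pk_cost i e.
Proof.
rewrite /copy_cost /= -[X in (i * X)%N](size_enum_ord n).
by rewrite (nth_allpairs _ _ i e) ?size_enum_ord // !nth_ord_enum.
Qed.

Lemma copies_gt0 : 0 < #|'I_M|.
Proof. by rewrite card_ord pk_M_gt0. Qed.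

Definition copy_weight (j : 'I_N) : R :=
  (penalty (fun j : 'I_N => copy_cost j) - copy_cost j)%R.

Definition intersection : wmi_instance R :=
  WmiInstance (direct_sum copy_bij (@pk_matroid R I))
              (few_full_matroid copy_bij (pk_k I) copies_gt0) copy_weight.

Implicit Types (A B : {set 'I_N}) (X : 'I_M -> {set 'I_n}).

Lemma pk_value_slices A :
  pk_value (slice copy A) = (\sum_(j in A) copy_cost j)%R.
Proof.
rewrite (big_slices copy_bij); apply: eq_bigr => i _.
by apply: eq_bigr => e _; rewrite copy_costE.
Qed.

Lemma pk_feasible_slices A :
  A \in bases (wmi_N1 intersection) -> A \in indep (wmi_N2 intersection) ->
  pk_feasible (slice copy A).
Proof. by rewrite mem_bases_direct_sum inE fullE => /forallP bA leAk; split. Qed.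

Lemma pk_feasible_glue X : pk_feasible X -> exists A,
  [/\ A \in bases (wmi_N1 intersection), A \in indep (wmi_N2 intersection) &
      slice copy A = X].
Proof.
move=> [bX leXk]; have [A sliceA] := glue_slices copy_bij X.
have eqX : slice copy A = X by apply: boolp.funext.
exists A; split=> //; last by rewrite inE fullE eqX.
by rewrite mem_bases_direct_sum; apply/forallP=> i; rewrite sliceA.
Qed.

(** A basis of the direct sum is heavier than any smaller common independent
    set; between bases the penalties cancel and only the costs compare. *)
Lemma wmi_optimal_slices A : wmi_optimal (J := intersection) A ->
  if A \in bases (wmi_N1 intersection) then pk_optimal (slice copy A)
  else ~ exists X, pk_feasible (I := I) X.
Proof.
rewrite /wmi_optimal /wmi_feasible => -[/setIP[i1A i2A] optA].
have le_basis B : B \in bases (wmi_N1 intersection) ->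
    B \in indep (wmi_N2 intersection) ->
    (\sum_(j in B) copy_weight j <= \sum_(j in A) copy_weight j)%R.
  move=> bB i2B; apply: optA; rewrite inE i2B andbT.
  by have [] := mem_basesP _ _ bB.
case: ifPn => bA.
  split; first exact: pk_feasible_slices.
  move=> Y /pk_feasible_glue[B [bB i2B <-]]; rewrite !pk_value_slices.
  have := le_basis _ bB i2B; rewrite !sum_penalty.
  have [_] := indep_leqif_basis i1A bB; rewrite bA => /eqP ->.
  lra.
case=> Y /pk_feasible_glue[B [bB i2B _]].
have := le_basis _ bB i2B; rewrite leNgt => /negP; apply.
apply: penalty_card.
by rewrite (ltn_leqif (indep_leqif_basis i1A bB)).
Qed.

End Instance.

(** * Reasoning about while programs *)

Section Programs.

Variables (R : realType) (orc : oracle).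
Implicit Types (s : store R) (post : store R -> Prop).

Lemma runs_within_le c s T T' post :
  runs_within orc c s T post -> T <= T' -> runs_within orc c s T' post.
Proof.
move=> [t [s' [ex leT ps]]] leT'; exists t, s'.
by split=> //; apply: leq_trans leT'.
Qed.

Lemma runs_within_seq c1 c2 s T1 T2 mid post :
  runs_within orc c1 s T1 mid ->
  (forall s', mid s' -> runs_within orc c2 s' T2 post) ->
  runs_within orc (Seq c1 c2) s (T1 + T2) post.
Proof.
move=> [t1 [s1 [ex1 le1 ps1]]] /(_ _ ps1)[t2 [s2 [ex2 le2 ps2]]].
exists (t1 + t2), s2; split=> //; first exact: ExecSeq ex1 ex2.
exact: leq_add.
Qed.

Lemma runs_within_if b c1 c2 s T post :
  runs_within orc (if beval s b then c1 else c2) s T post ->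
  runs_within orc (If b c1 c2) s T.+1 post.
Proof.
case: ifPn => bs [t [s' [ex leT ps]]]; exists t.+1, s'; split=> //.
  exact: ExecIfTrue.
exact: ExecIfFalse.
Qed.

(** The index of the invariant bounds the number of remaining iterations, so
    that one argument gives termination, the time bound and the result. *)
Lemma runs_within_while (Inv : nat -> store R -> Prop) b c T post j s :
  (forall j s, Inv j s ->
     if beval s b
     then exists2 j', j = j'.+1 & runs_within orc c s T (Inv j')
     else post s) ->
  Inv j s -> runs_within orc (While b c) s (j * T.+1).+1 post.
Proof.
move=> step; elim: j s => [|j IHj] s invs; have := step _ _ invs; case: ifP => bs.
- by case.
- by exists 1, s; split=> //; apply: ExecWhileFalse; rewrite bs.
- case=> _ [<-] [t1 [s1 [ex1 le1 /IHj[t2 [s2 [ex2 le2 ps2]]]]]].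
  exists (t1 + t2).+1, s2; split=> //; first exact: ExecWhileTrue ex1 ex2.
  by rewrite mulSn; lia.
by exists 1, s; split=> //; apply: ExecWhileFalse; rewrite bs.
Qed.

Fixpoint loop_free c : bool :=
  match c with
  | Seq c1 c2 | If _ c1 c2 => loop_free c1 && loop_free c2
  | While _ _ => false
  | _ => true
  end.

Fixpoint cmd_size c : nat :=
  match c with
  | Seq c1 c2 | If _ c1 c2 => (cmd_size c1 + cmd_size c2).+1
  | While _ c1 => (cmd_size c1).+1
  | _ => 1
  end.

(** Denotes [c] only when it is free of loops: a loop is left unexecuted. *)
Fixpoint run c s : store R :=
  match c with
  | Skip | While _ _ => s
  | NSet a e => nwrite s (neval s a) (neval s e)
  | RSet a e => rwrite s (neval s a) (reval s e)
  | Query a i b =>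
      nwrite s (neval s a)
        (orc (neval s i) (fun j => nmem s (neval s b + j) != 0))
  | Seq c1 c2 => run c2 (run c1 s)
  | If b c1 c2 => if beval s b then run c1 s else run c2 s
  end.

Lemma runs_within_loop_free c s post :
  loop_free c -> post (run c s) -> runs_within orc c s (cmd_size c) post.
Proof.
move=> free_c ps.
suff [t ex le_t] : exists2 t, exec orc c s t (run c s) & t <= cmd_size c.
  by exists t, (run c s).
elim: c s free_c {ps} => //=; try by (move=> *; exists 1 => //; constructor).
- move=> c1 IH1 c2 IH2 s /andP[/(IH1 s)[t1 ex1 le1] /(IH2 (run c1 s))[t2 ex2 le2]].
  by exists (t1 + t2); [apply: ExecSeq ex1 ex2 | lia].
- move=> b c1 IH1 c2 IH2 s /andP[/(IH1 s)[t1 ex1 le1] /(IH2 s)[t2 ex2 le2]].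
  case: ifPn => bs.
    by exists t1.+1; [apply: ExecIfTrue | lia].
  by exists t2.+1; [apply: ExecIfFalse | lia].
Qed.

End Programs.

(** * The programs of the reduction *)

Local Coercion NConst : nat >-> nexp.
Local Notation "c1 ;; c2" := (Seq c1 c2) (at level 60, right associativity).
Local Notation "a ::= e" := (NSet a e) (at level 55).
Local Notation cell a := (NGet (NConst a)).

(** Computes N = M * n by repeated addition, then the penalty in the first
    real cell behind the costs, and finally replaces each cost by a weight. *)
Definition build : cmd :=
  While (NLe 1 (cell 1))
    (1 ::= NSub (cell 1) 1 ;; 3 ::= NAdd (cell 3) (cell 0)) ;;
  (RSet (cell 3) (RConst 1) ;; 1 ::= cell 3) ;;
  While (NLe 1 (cell 1))
    (1 ::= NSub (cell 1) 1 ;;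
     If (RLe (RConst 0) (RGet (cell 1)))
        (RSet (cell 3) (RAdd (RGet (cell 3)) (RGet (cell 1))))
        (RSet (cell 3) (RSub (RGet (cell 3)) (RGet (cell 1))))) ;;
  1 ::= cell 3 ;;
  While (NLe 1 (cell 1))
    (1 ::= NSub (cell 1) 1 ;;
     RSet (cell 1) (RSub (RGet (cell 3)) (RGet (cell 1)))) ;;
  0 ::= cell 3.

(** Queries the slices from the last to the first: cell 1 is the index of the
    slice, cell 3 its offset and cell 2 the conjunction of the answers. *)
Definition orc1 : cmd :=
  2 ::= 1 ;;
  While (BAnd (NLe 1 (cell 1)) (NLe 1 (cell 2)))
    (1 ::= NSub (cell 1) 1 ;; 3 ::= NSub (cell 3) (cell 0) ;;
     Query 2 (cell 1) (NAdd 4 (cell 3))) ;;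
  0 ::= cell 2.

(* Two variables in the first free cells behind the N bits, N being the
   content of cell 3. *)
Local Notation ptr := (NAdd 4 (cell 3)).
Local Notation offset := (NAdd 5 (cell 3)).

(** For each e, counted down in cell 1, [ptr] descends the column of e from
    N + e in steps of n, and drops below n precisely when the column is full.
    Cell 2 holds k + 1 minus the number of full columns, truncated at 0. *)
Definition orc2 : cmd :=
  (2 ::= NAdd (cell 2) 1 ;; 1 ::= cell 0) ;;
  While (NLe 1 (cell 1))
    ((1 ::= NSub (cell 1) 1 ;; ptr ::= NAdd (cell 1) (cell 3)) ;;
     While (BAnd (NLe (cell 0) (NGet ptr))
                 (NLe 1 (NGet (NAdd 4 (NSub (NGet ptr) (cell 0))))))
       (ptr ::= NSub (NGet ptr) (cell 0)) ;;
     If (NLe (cell 0) (NGet ptr)) Skip (2 ::= NSub (cell 2) 1)) ;;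
  If (NLe 1 (cell 2)) (0 ::= 1) (0 ::= 0).

(** Scans the copies downwards, [ptr] being the current copy, cell 1 the index
    of its slice and [offset] the position of that slice.  A copy outside the
    set is added for the duration of one query, and cell 2 becomes 1 as soon as
    the enlarged slice is independent. *)
Definition scan_extensions : cmd :=
  While (BAnd (NLe 1 (NGet ptr)) (NLe (cell 2) 0))
    ((ptr ::= NSub (NGet ptr) 1 ;;
      If (NLe (NGet offset) (NGet ptr)) Skip
         (1 ::= NSub (cell 1) 1 ;; offset ::= NSub (NGet offset) (cell 0))) ;;
     If (NLe 1 (NGet (NAdd 4 (NGet ptr)))) Skip
        (NAdd 4 (NGet ptr) ::= 1 ;;
         Query 2 (cell 1) (NAdd 4 (NGet offset)) ;;
         NAdd 4 (NGet ptr) ::= 0)).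

(** Moves the bits from position 4 to position 1, which overwrites n, M and N:
    the end is recognized by a cell that is neither 0 nor 1. *)
Definition shift_bits : cmd :=
  While (NLe (NGet (NAdd 4 (cell 0))) 1)
    (NAdd 1 (cell 0) ::= NGet (NAdd 4 (cell 0)) ;; 0 ::= NAdd (cell 0) 1).

Definition recover : cmd :=
  (2 ::= 0 ;; ptr ::= cell 3 ;; offset ::= cell 3) ;;
  scan_extensions ;;
  If (NLe 1 (cell 2)) (0 ::= 0)
    ((0 ::= 0 ;; ptr ::= 2) ;; shift_bits ;; 0 ::= 1).

Lemma forall_tail m (P : pred 'I_m) (j : 'I_m) :
  [forall i : 'I_m, (j <= i) ==> P i] =
  P j && [forall i : 'I_m, (j < i) ==> P i].
Proof.
apply/forall_inP/andP => [allP | [Pj /forall_inP allP] i].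
  by split; [apply: allP | apply/forall_inP=> i /ltnW /allP].
by rewrite leq_eqVlt => /orP[/eqP /val_inj <- // | /allP].
Qed.

Lemma forall_tail_out m (P : pred 'I_m) :
  [forall i : 'I_m, (m <= i) ==> P i] = true.
Proof. by apply/forallP=> i; rewrite leqNgt ltn_ord. Qed.

Lemma card_tail m (F : {set 'I_m}) (j : 'I_m) :
  #|[set i in F | j <= i]| = (j \in F) + #|[set i in F | j < i]|.
Proof.
rewrite (cardsD1 j) !inE leqnn andbT; congr (_ + _); apply: eq_card => i.
by rewrite !inE andbCA [j < i]ltn_neqAle eq_sym.
Qed.

(** Executing a write leaves a comparison of addresses at each later read;
    these comparisons are decided by linear arithmetic. *)
Ltac decide_addr := repeat match goal with
  | |- context [@eq_op ?X ?a ?b] =>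
    first [rewrite (_ : @eq_op X a b = false); last by lia
          |rewrite (_ : @eq_op X a b = true); last by lia]
  end.

Section Correctness.

Variables (R : realType) (I : pk_instance R).
Notation n := (pk_n I).
Notation M := (pk_M I).
Notation N := (M * n).
Notation J := (intersection I).
Implicit Types s : store R.

Lemma build_correct : runs_within (pk_oracle I) build (pk_input I [::])
  (10 * M + 20 * N + 20) (writes_wmi J).
Proof.
pose inv1 j s := [/\ nmem s 0 = n, nmem s 1 = j,
  nmem s 3 + j * n = N & rmem s = @copy_cost R I].
pose inv2 j s := [/\ nmem s 1 = j, nmem s 3 = N, j <= N,
  forall x, x < N -> rmem s x = copy_cost I x &
  rmem s N = (1 + \sum_(j <= x < N) `|copy_cost I x|)%R].
pose C := penalty (fun j : 'I_N => copy_cost I j).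
pose inv3 j s := [/\ nmem s 1 = j, nmem s 3 = N, j <= N, rmem s N = C &
  forall x, x < N ->
    rmem s x = if x < j then copy_cost I x else (C - copy_cost I x)%R].
apply: (@runs_within_le _ _ _ _ ((M * 4).+1 + (3 + ((N * 6).+1 +
  (1 + ((N * 4).+1 + 1)))))); last lia.
apply: (runs_within_seq (mid := inv1 0)).
  apply: (runs_within_while (Inv := inv1)); last by split.
  move=> j s [s0 s1 s3 rs]; rewrite /= s1; case: j s1 s3 => [|j] s1 s3 /=.
    by split.
  exists j => //; apply: runs_within_loop_free => //.
  by split=> //=; rewrite ?s1 ?s0; lia.
move=> s [_ _ s3 rs]; rewrite addn0 in s3.
apply: (runs_within_seq (mid := inv2 N)).
  apply: runs_within_loop_free => //; split=> //=.
    by move=> x ltx; rewrite ifF ?rs //; lia.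
  by rewrite ifT ?big_geq ?addr0 //; lia.
move=> {s3 rs}s invs.
apply: (runs_within_seq (mid := inv2 0)).
  apply: (runs_within_while (Inv := inv2)); last exact: invs.
  move=> {invs}j {}s [s1 s3 lejN rs rsN]; rewrite /= s1.
  case: j s1 lejN rsN => [|j] s1 lejN rsN /=; first by split.
  exists j => //; apply: runs_within_loop_free => //=.
  (* Both branches add the absolute value of the j-th cost. *)
  rewrite !s1 !s3 subn1 /= rs // rsN (_ : (if _ then _ else _) =
    rwrite (nwrite s 1 j) N (1 + \sum_(j <= x < N) `|copy_cost I x|)%R).
    split=> //=; first lia; last by rewrite eqxx.
    by move=> x ltx; rewrite ifF ?rs //; lia.
  rewrite (big_ltn lejN) /=; case: (lerP 0%R (copy_cost I j)) => cj.
    by rewrite [in RHS]addrA [in RHS]addrAC ger0_norm.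
  by rewrite [in RHS]addrA [in RHS]addrAC ltr0_norm.
move=> {invs}s [_ s3 _ rs rsN].
apply: (runs_within_seq (mid := inv3 N)).
  apply: runs_within_loop_free => //; split=> //=.
    by rewrite rsN big_mkord.
  by move=> x ltx; rewrite ltx rs.
move=> {rs rsN s3}s invs.
apply: (runs_within_seq (mid := inv3 0)).
  apply: (runs_within_while (Inv := inv3)); last exact: invs.
  move=> {invs}j {}s [s1 s3 lejN rsN rs]; rewrite /= s1.
  case: j s1 lejN rs => [|j] s1 lejN rs /=; first by split.
  exists j => //; apply: runs_within_loop_free => //; split=> //=.
  - by rewrite s1 subn1.
  - exact: ltnW.
  - by rewrite s1 subn1 ifF //=; lia.
  move=> x ltx; rewrite s1 s3 subn1 /= rsN !rs // ltnS leqnn.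
  by case: (ltngtP x j) => [||->] //; rewrite ltnS; case: ltngtP.
move=> {invs}s [_ s3 _ _ rs].
by apply: runs_within_loop_free => //; split=> //= j; rewrite rs.
Qed.

Lemma pk_oracle_slice (f : nat -> bool) (i : 'I_M) (X : {set 'I_n}) :
  (forall e : 'I_n, f e = (e \in X)) ->
  pk_oracle I i f = (X \in indep (pk_matroid i)).
Proof.
move=> fX.
have -> : X = [set e : 'I_n | f e] by apply/setP=> e; rewrite inE fX.
by rewrite /pk_oracle valK.
Qed.

Section SetOfCopies.

Variable A : {set 'I_N}.
Notation input := (pk_input I (indicator A)).

Definition holds_bits (b : nat) s := forall j : 'I_N, nmem s (b + j) = (j \in A).

Lemma nmem_input3 : nmem input 3 = N.
Proof. by rewrite /= size_map size_enum_ord. Qed.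

Lemma input_holds_bits : holds_bits 4 input.
Proof.
move=> j; rewrite -[LHS]/(nth 0 (map nat_of_bool (indicator A)) j).
by rewrite /indicator -map_comp (nth_map j) ?size_enum_ord //= nth_ord_enum.
Qed.

Lemma orc1_correct : runs_within (pk_oracle I) orc1 input (10 * M + 10)
  (writes_bool (A \in indep (wmi_N1 J))).
Proof.
pose P i := slice (@copy R I) A i \in indep (pk_matroid i).
pose inv j s := [/\ nmem s 0 = n, nmem s 1 = j, nmem s 3 = j * n,
  nmem s 2 = [forall i : 'I_M, (j <= i) ==> P i] & j <= M /\ holds_bits 4 s].
apply: (@runs_within_le _ _ _ _ (1 + ((M * 6).+1 + 1))); last lia.
apply: (runs_within_seq (mid := inv M)).
  apply: runs_within_loop_free => //; split=> //.
  - exact: nmem_input3.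
  - by rewrite forall_tail_out.
  by split=> //; apply: input_holds_bits.
move=> s invs.
apply: (runs_within_seq (mid := fun s => nmem s 2 = (A \in indep (wmi_N1 J)))).
  apply: (runs_within_while (Inv := inv)); last exact: invs.
  move=> {invs}j {}s [s0 s1 s3 s2 [lejM bits]].
  rewrite /= s1 s2 inE; case: j s1 s2 s3 lejM => [|j] s1 s2 s3 lejM /=.
    by congr nat_of_bool; apply: eq_forallb => i.
  rewrite lt0b; case: ifPn => [tail | ntail]; last first.
    rewrite (negPf ntail); congr nat_of_bool; symmetry; apply/negbTE.
    apply: contra ntail => /forallP allP.
    by apply/forall_inP=> i _; apply: allP.
  exists j => //; apply: runs_within_loop_free => //; split=> //=.
  - by rewrite s1 subn1.
  - by rewrite s0 s3; lia.
  - have := forall_tail P (Ordinal lejM); rewrite tail andbT => ->.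
    congr nat_of_bool; rewrite s1 subn1.
    apply: (pk_oracle_slice (Ordinal lejM)) => e.
    rewrite s0 s3 -addnA (_ : _ + e = copy (Ordinal lejM, e)).
      by rewrite bits inE eqb0 negbK.
    by rewrite /=; lia.
  by split=> //; lia.
by move=> {invs}s s2; apply: runs_within_loop_free.
Qed.

Lemma orc2_correct :
  runs_within (pk_oracle I) orc2 input (20 * N + 20 * n + 20)
    (writes_bool (A \in indep (wmi_N2 J))).
Proof.
pose F := full (@copy R I) A.
pose inv K j s := [/\ nmem s 0 = n, nmem s 1 = j, nmem s 2 = K,
  nmem s 3 = N & holds_bits 4 s].
pose f j := #|[set e in F | j <= e]|.
pose outer j s := j <= n /\ inv ((pk_k I).+1 - f j) j s.
apply: (@runs_within_le _ _ _ _
  (3 + ((n * (3 + ((M * 2).+1 + 3)).+1).+1 + 3))); last nia.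
apply: (runs_within_seq (mid := outer n)).
  apply: runs_within_loop_free => //; split=> //; split=> //=.
  - rewrite /f (_ : [set e in F | _] = set0) ?cards0 ?subn0 ?addn1 //.
    by apply/setP=> e; rewrite !inE leqNgt ltn_ord andbF.
  - exact: nmem_input3.
  exact: input_holds_bits.
move=> s invs.
apply: (runs_within_seq (mid := outer 0)).
  apply: (runs_within_while (Inv := outer)); last exact: invs.
  move=> {invs}j {}s [lejn [s0 s1 s2 s3 bits]].
  rewrite /= s1; case: j lejn s1 s2 => [|j] lejn s1 s2 /=; first by split.
  exists j => //; pose e := Ordinal lejn.
  set K := _ - _ in s2.
  pose inner i s := [/\ inv K j s, nmem s (4 + N) = j + i * n, i <= M &
    forall i' : 'I_M, i <= i' -> copy (i', e) \in A].
  apply: (runs_within_seq (mid := inner M)).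
    apply: runs_within_loop_free => //; split=> //=.
    - split=> //=; rewrite ?s3 ?s1 ?subn1 //.
      by move=> t; rewrite /= eqn_add2l ltn_eqF //= bits.
    - by rewrite s3 s1 subn1 eqxx.
    by move=> i; rewrite leqNgt ltn_ord.
  move=> {s0 s1 s2 s3 bits}s invs.
  apply: (runs_within_seq (mid := fun s => inv K j s /\
    (n <= nmem s (4 + N)) = (e \notin F))).
    apply: (runs_within_while (Inv := inner)); last exact: invs.
    move=> {invs}i {}s [[s0 s1 s2 s3 bits] sp leiM in_i].
    rewrite /= s3 s0 sp; case: i leiM sp in_i => [|i] leiM sp in_i.
      rewrite addn0 leqNgt lejn /=; split=> //.
      apply/esym/negbTE; rewrite negbK /F fullE.
      by apply/bigcapP=> i _; rewrite inE in_i.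
    rewrite (_ : n <= _) ?leq_addl //=; last by lia.
    rewrite (_ : j + i.+1 * n - n = copy (Ordinal leiM, e)).
      2: by rewrite /=; lia.
    rewrite bits lt0b; case: ifPn => inA.
      exists i => //; apply: runs_within_loop_free => //; split=> //=.
      - split=> //=; rewrite ?s3 //.
        by move=> t; rewrite /= eqn_add2l ltn_eqF //= bits.
      - by rewrite s3 eqxx s0 sp; lia.
      - exact: ltnW.
      move=> i'; rewrite leq_eqVlt => /orP[/eqP eq_i | /in_i //].
      by rewrite (_ : i' = Ordinal leiM) //; apply: val_inj.
    split=> //; apply/esym.
    rewrite /F fullE; apply/bigcapP => /(_ (Ordinal leiM) isT).
    by rewrite inE (negPf inA).
  move=> {invs}s [[s0 s1 s2 s3 bits] sp].
  apply: runs_within_loop_free => //=; rewrite s3 s0 sp.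
  split; first exact: ltnW.
  have := card_tail F e; rewrite -/(f e) -/(f e.+1) /= => fS.
  by case: (e \in F) fS => /= fS; split=> //=; rewrite s2 /K; lia.
move=> {invs}s [_ [s0 s1 s2 s3 bits]].
apply: runs_within_loop_free => //=; rewrite s2 /writes_bool inE.
have -> : f 0 = #|F| by apply: eq_card => e; rewrite !inE andbT.
by rewrite subn_gt0 ltnS; case: leqP.
Qed.

Lemma mem_bases_extensions : A \in indep (wmi_N1 J) ->
  (A \in bases (wmi_N1 J)) =
  [forall t, (t \in A) || (t |: A \notin indep (wmi_N1 J))].
Proof.
move=> iA; apply/mem_basesP/forallP => [[_ maxA] t | extA].
  by case: (boolP (t \in A)) => //= /maxA.
by split=> // t tA; have := extA t; rewrite (negPf tA).
Qed.

Lemma scan_extensions_correct s : A \in indep (wmi_N1 J) ->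
  [/\ nmem s 0 = n, nmem s 1 = M, nmem s 2 = 0 & nmem s 3 = N] ->
  [/\ nmem s (4 + N) = N, nmem s (5 + N) = N & holds_bits 4 s] ->
  runs_within (pk_oracle I) scan_extensions s (N * 20).+1 (fun s' =>
    [/\ nmem s' 2 = (A \notin bases (wmi_N1 J)), nmem s' 3 = N &
        holds_bits 4 s']).
Proof.
move=> iA [s0 s1 s2 s3] [sp so bits].
rewrite mem_bases_extensions //.
pose ext (t : 'I_N) := (t \in A) || (t |: A \notin indep (wmi_N1 J)).
rewrite -/([forall t, ext t]).
pose scan (p i flag : nat) s := [/\ nmem s 0 = n, nmem s 1 = i,
  nmem s 2 = flag, nmem s 3 = N &
  [/\ nmem s (4 + N) = p, nmem s (5 + N) = i * n & holds_bits 4 s]].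
(* When [p] is i * n, slice i is finished and the next iteration moves to the
   slice below; at the start this holds with i = M. *)
pose inv p s := exists2 i, [&& i <= M, p <= N & i * n <= p <= i * n + n] &
  scan p i (~~ [forall t : 'I_N, (p <= t) ==> ext t]) s.
have invs : inv N s.
  by exists M; [rewrite !leqnn leq_addr | rewrite forall_tail_out].
apply: (@runs_within_le _ _ _ _ (N * 15).+1); last lia.
apply: (runs_within_while (Inv := inv)); last exact: invs.
move=> {s0 s1 s2 s3 sp so bits invs}p {}s.
move=> [i /and4P[leiM le_pN le_ip le_pi] [s0 s1 s2 s3 [sp so bits]]].
rewrite /= s3 sp s2.
case: p le_pN le_ip le_pi s2 sp => [|p] lt_pN le_ip le_pi s2 sp /=.
  by split.
rewrite leqn0 eqb0 negbK; case: ifPn => [tail | ntail]; last first.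
  split=> //; rewrite (negPf ntail) (_ : [forall t, ext t] = false) //.
  apply: contraNF ntail => /forallP extA.
  by apply/forall_inP=> t _; apply: extA.
exists p => //; rewrite tail in s2.
apply: (@runs_within_le _ _ _ _ (7 + 7)); last by [].
apply: (runs_within_seq (mid :=
  fun s => exists2 i : 'I_M, i * n <= p < i * n + n & scan p i 0 s)).
  apply: runs_within_loop_free => //=.
  rewrite s3 s0 s1 sp so; decide_addr; rewrite subn1 /=.
  have [le_ip' | lt_pi] := leqP (i * n) p.
    have lt_iM : i < M by nia.
    exists (Ordinal lt_iM); first by rewrite /= le_ip'.
    split=> //=; split=> [| |t]; decide_addr => //.
    by have := ltn_ord t => ltt; rewrite /=; decide_addr; apply: bits.
  have i_gt0 : 0 < i by case: i lt_pi {leiM le_ip le_pi s1 so}.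
  have n_gt0 : 0 < n by nia.
  have lt_iM : i.-1 < M by lia.
  have pred_i : i.-1 * n + n = i * n by rewrite -mulSnr prednK.
  exists (Ordinal lt_iM); first by rewrite /=; lia.
  split=> //=; rewrite ?subn1 //; split=> [| |t]; decide_addr => //=.
    by rewrite -pred_i addnK.
  by have := ltn_ord t => ltt; decide_addr; apply: bits.
move=> {i leiM le_ip le_pi s0 s1 s2 s3 sp so bits}s.
move=> [i /andP[le_ip lt_pi] [s0 s1 s2 s3 [sp so bits]]].
have lt_e : p - i * n < n by lia.
pose t := copy (i, Ordinal lt_e).
have def_p : p = t by rewrite /=; lia.
have flagE : [forall u : 'I_N, (p <= u) ==> ext u] = ext t.
  by rewrite def_p forall_tail -def_p tail andbT.
have bit_p : nmem s (4 + p) = (t \in A) by rewrite def_p bits.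
apply: runs_within_loop_free => //=.
exists i; first by have := ltn_ord i; lia.
rewrite flagE s3 sp bit_p lt0b /ext; case: ifPn => inA; first by split.
rewrite negbK direct_sum_setU1 // s1 so; decide_addr; split=> //=; decide_addr.
  congr nat_of_bool; apply: pk_oracle_slice => e.
  have bit_e : (nmem s (4 + (i * n + e)) != 0) = (copy (i, e) \in A).
    by rewrite (bits (copy (i, e))) eqb0 negbK.
  rewrite -addnA eqn_add2l in_setU1 inE -bit_e -val_eqE /=.
  rewrite (_ : (_ == p) = (e == p - i * n :> nat)); last by lia.
  by case: (e == p - i * n :> nat).
split=> [| |u]; decide_addr => //=.
have := ltn_ord u => ltu; decide_addr; rewrite eqn_add2l def_p.
by case: eqP => [/val_inj -> | _]; [rewrite (negPf inA) | apply: bits].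
Qed.

Lemma shift_bits_correct s :
  nmem s 0 = 0 -> nmem s (4 + N) = 2 -> holds_bits 4 s ->
  runs_within (pk_oracle I) shift_bits s (N * 4).+1 (holds_bits 1).
Proof.
move=> s0 sN bits.
pose inv j s := [/\ nmem s 0 + j = N, nmem s (4 + N) = 2 & forall t : 'I_N,
  nmem s (if t < nmem s 0 then 1 + t else 4 + t) = (t \in A)].
have invs : inv N s by split=> [||t] //; rewrite s0 ?bits.
apply: (runs_within_while (Inv := inv)); last exact: invs.
move=> {s0 sN bits invs}j {}s [s0 sN bits]; rewrite /=.
case: j s0 => [|j] s0.
  rewrite addn0 in s0; rewrite s0 sN => t.
  by have := bits t; rewrite s0 ltn_ord.
have lt_p : nmem s 0 < N by lia.
have := bits (Ordinal lt_p); rewrite ltnn => bit_p.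
rewrite bit_p leq_b1.
exists j => //; apply: runs_within_loop_free => //; split=> /=.
- by decide_addr; lia.
- by decide_addr.
move=> t; decide_addr; have := bits t; have := ltn_ord t.
have [lt_t | gt_t | eq_t] := ltngtP t (nmem s 0) => ltt <-.
- by rewrite (_ : t < _ + 1); [decide_addr | lia].
- by rewrite (_ : t < _ + 1 = false); [decide_addr | lia].
by rewrite eq_t addn1 ltnSn; decide_addr.
Qed.

Lemma recover_correct : wmi_optimal (J := J) A ->
  runs_within (pk_oracle I) recover input (50 * N + 50) (@writes_answer R I).
Proof.
move=> optA; have ans := wmi_optimal_slices optA.
have iA : A \in indep (wmi_N1 J) by case: optA => /setIP[].
have t0 : nmem input 0 = n by [].
have t1 : nmem input 1 = M by [].
move: (input) t0 t1 nmem_input3 input_holds_bits => tape t0 t1 t3 bits.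
apply: (@runs_within_le _ _ _ _
  (5 + ((N * 20).+1 + (1 + (3 + ((N * 4).+1 + 1)))))); last lia.
apply: (runs_within_seq (mid := fun s =>
  [/\ nmem s 0 = n, nmem s 1 = M, nmem s 2 = 0 & nmem s 3 = N] /\
  [/\ nmem s (4 + N) = N, nmem s (5 + N) = N & holds_bits 4 s])).
  apply: runs_within_loop_free => //; split=> //=.
  rewrite !t3; split=> [| |t]; decide_addr => //=.
  by have := ltn_ord t => ltt; decide_addr; apply: bits.
move=> s [regs ptrs].
apply: (runs_within_seq (scan_extensions_correct iA regs ptrs)).
move=> {regs ptrs t0 t1 t3 bits}{}s [s2 s3 bits].
apply: runs_within_if; rewrite /= s2; case: ifP ans => bA ans; last first.
  apply: (@runs_within_le _ _ _ _ 1); last by lia.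
  by apply: runs_within_loop_free => //; left.
apply: (runs_within_seq (mid := fun s =>
  [/\ nmem s 0 = 0, nmem s (4 + N) = 2 & holds_bits 4 s])).
  apply: runs_within_loop_free => //; split=> //= [|t].
    by rewrite s3; decide_addr.
  by have := ltn_ord t => ltt; rewrite /= s3; decide_addr; apply: bits.
move=> {s2 s3 bits}s [s0 sN bits].
apply: (runs_within_seq (shift_bits_correct s0 sN bits)).
move=> {s0 sN bits}s bits; apply: runs_within_loop_free => //; right.
split=> //; rewrite (_ : output_sets _ = slice (@copy R I) A) //.
apply: boolp.funext => i; apply/setP=> e; rewrite !inE /=.
by rewrite -addnA (bits (copy (i, e))) eqb0 negbK.
Qed.

End SetOfCopies.

End Correctness.

Theorem theorem5 (R : realType) :
  exists (build orc1 orc2 recover : cmd) (p : {poly nat}),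
    forall I : pk_instance R, exists J : wmi_instance R,
      reduces_instance build orc1 orc2 recover (p.[pk_size I])%R I J.
Proof.
exists build, orc1, orc2, recover, (('X^2 + 'X + 1) *+ 50)%R => I.
exists (intersection I).
have -> : (('X^2 + 'X + 1) *+ 50).[pk_size I]%R =
    50 * (pk_size I * pk_size I + pk_size I + 1) :> nat.
  by rewrite hornerMn !hornerD hornerXn hornerX hornerC; lia.
have leN : pk_M I * pk_n I <= pk_size I * pk_size I by rewrite /pk_size; nia.
have [leM len] : pk_M I <= pk_size I /\ pk_n I <= pk_size I.
  by rewrite /pk_size; lia.
split=> [||A|A|A optA].
- by rewrite /=; lia.
- by apply: runs_within_le (build_correct I) _; lia.
- by apply: runs_within_le (orc1_correct A) _; lia.
- by apply: runs_within_le (orc2_correct A) _; lia.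
by apply: runs_within_le (recover_correct optA) _; lia.
Qed.
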